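(* Let $X$ be a uniformly convex Banach space and let $U$ be an m-process on $X$. The following are equivalent. (1) $U$ is asymptotically compact. (2) For every $B\in\mathcal B(X)$, the nonautonomous set $\Omega(B)=\{\omega(t,B):t\in\mathbb R\}$ is nonempty (i.e. each $\omega(t,B)\neq\emptyset$), compact, and it pullback attracts $B$. (3) $U$ is pullback $\omega$-limit compact. (4) $U$ is pullback flattening.
   Context: $P(X)$ is the family of nonempty subsets of $X$, $\mathcal B(X)$ the family of nonempty bounded subsets of $X$, $\varrho(x,y)=\|x-y\|$, $\mathbb R_d=\{(s,t)\in\mathbb R^2: s\ge t\}$. For a point $y$ and sets $A,B\subset X$: $\mathrm{dist}(y,B)=\inf_{x\in B}\varrho(x,y)$ and $\mathrm{dist}(A,B)=\sup_{y\in A}\mathrm{dist}(y,B)$ (Hausdorff semidistance). An m-process on $X$ is a map $U:\mathbb R_d\times X\to P(X)$, $(t,\tau,x)\mapsto U(t,\tau;x)$, such that (i) $U(t,t;x)=\{x\}$ for all $t\in\mathbb R$, $x\in X$; (ii) $U(t,\tau;x)\subset U(t,s;U(s,\tau;x))$ for all $t\ge s\ge\tau$, $x\in X$, where $U(t,s;A)=\bigcup_{y\in A}U(t,s;y)$ for $A\subset X$. No continuity is assumed. A nonautonomous set is a family $\{K(t)\subset X:t\in\mathbb R\}$; it is compact if every $K(t)$ is compact. It pullback attracts $B$ if $\lim_{\tau\to-\infty}\mathrm{dist}(U(t,\tau;B),K(t))=0$ for every $t\in\mathbb R$. $\omega(t,B)=\bigcap_{s\le t}\overline{\bigcup_{\tau\le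 s}U(t,\tau;B)}$ for $t\in\mathbb R$, $B\in\mathcal B(X)$. $U$ is (pullback) asymptotically compact if for every $B\in\mathcal B(X)$, $t\in\mathbb R$ and any sequences $\tau_n\to-\infty$, $\xi_n\in U(t,\tau_n;B)$, the sequence $(\xi_n)$ has a subsequence converging in $X$. $\kappa(B)=\inf\{\delta: B$ has a finite cover by balls of $X$ of diameter less than $\delta\}$ is the Kuratowski measure of noncompactness ($\inf\emptyset=+\infty$). $U$ is pullback $\omega$-limit compact if for every $B\in\mathcal B(X)$ and $t\in\mathbb R$, $\lim_{\tau\to-\infty}\kappa\big(\bigcup_{s\le\tau}U(t,s;B)\big)=0$. $U$ is pullback flattening if for every $B\in\mathcal B(X)$, $t\in\mathbb R$ and $\varepsilon>0$ there exist $\tau\le t$, a finite dimensional subspace $E$ of $X$ and a mapping $P_E:X\to E$ such that $P_E\big(\bigcup_{s\le\tau}U(t,s;B)\big)\in\mathcal B(X)$ and $(I-P_E)\big(\bigcup_{s\le\tau}U(t,s;B)\big)\subset B(0,\varepsilon)$, the ball of radius $\varepsilon$ centered at $0$. *)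

(* Defs.v *)
From HB Require Import structures.
From mathcomp Require Import all_boot all_order all_algebra.
From mathcomp Require Import all_classical all_reals all_analysis.

Set Implicit Arguments.
Unset Strict Implicit.
Unset Printing Implicit Defensive.

Import Order.TTheory GRing.Theory Num.Theory.
Import numFieldNormedType.Exports.

Local Open Scope classical_set_scope.
Local Open Scope ring_scope.

(* Clarkson's definition. *)
Definition uniformly_convex (R : realType) (X : normedModType R) : Prop :=
  forall eps : R, 0 < eps -> eps <= 2 ->
  exists2 delta : R, 0 < delta &
    forall x y : X, `|x| = 1 -> `|y| = 1 -> eps <= `|x - y| ->
      `|2^-1 *: (x + y)| <= 1 - delta.

Definition nonempty_bounded (R : realType) (X : normedModType R)
    (B : set X) : Prop :=
  B !=set0 /\ bounded_set B.

Definition mp_image (R : realType) (X : normedModType R)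
    (U : R -> R -> X -> set X) (t s : R) (A : set X) : set X :=
  \bigcup_(y in A) U t s y.

(* U(t, tau; x) is meaningful only for tau <= t; a total function is used for
   U, its values for t < tau are unconstrained, and none of the notions below
   depends on them. *)
Record m_process (R : realType) (X : normedModType R)
    (U : R -> R -> X -> set X) : Prop := MProcess {
  mp_nonempty : forall (t tau : R) (x : X), tau <= t -> U t tau x !=set0 ;
  mp_diag : forall (t : R) (x : X), U t t x = [set x] ;
  mp_comp : forall (t s tau : R) (x : X), tau <= s -> s <= t ->
    U t tau x `<=` mp_image U t s (U s tau x)
}.

(* The union of U(t, s; B) over all s <= tau (meant for tau <= t). *)
Definition mp_past (R : realType) (X : normedModType R)
    (U : R -> R -> X -> set X) (t : R) (B : set X) (tau : R) : set X :=
  \bigcup_(s in [set s : R | s <= tau]) mp_image U t s B.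

Definition omega (R : realType) (X : normedModType R)
    (U : R -> R -> X -> set X) (t : R) (B : set X) : set X :=
  \bigcap_(s in [set s : R | s <= t]) closure (mp_past U t B s).

Definition dist_point (R : realType) (X : normedModType R)
    (y : X) (B : set X) : \bar R :=
  ereal_inf [set (`|x - y|)%:E | x in B].

Definition dist_set (R : realType) (X : normedModType R)
    (A B : set X) : \bar R :=
  ereal_sup [set dist_point y B | y in A].

Definition compact_family (R : realType) (X : normedModType R)
    (K : R -> set X) : Prop :=
  forall t : R, compact (K t).

Definition pullback_attracts (R : realType) (X : normedModType R)
    (U : R -> R -> X -> set X) (K : R -> set X) (B : set X) : Prop :=
  forall t : R,
    dist_set (mp_image U t tau B) (K t) @[tau --> -oo%R] --> 0%E.

Definition asymptotically_compact (R : realType) (X : normedModType R)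
    (U : R -> R -> X -> set X) : Prop :=
  forall (B : set X) (t : R), nonempty_bounded B ->
  forall (tau : nat -> R) (xi : nat -> X),
    (forall n, tau n <= t) -> tau @ \oo --> -oo%R ->
    (forall n, mp_image U t (tau n) B (xi n)) ->
  exists (phi : nat -> nat) (l : X),
    {homo phi : m n / (m < n)%N} /\ (xi \o phi) @ \oo --> l.

Definition diameter (R : realType) (X : normedModType R)
    (A : set X) : \bar R :=
  ereal_sup [set (`|p.1 - p.2|)%:E | p in A `*` A].

(* The balls of the cover are listed as pairs (center, radius).  The infimum
   is taken in the extended reals, where the infimum of the empty set is +oo. *)
Definition kuratowski (R : realType) (X : normedModType R)
    (B : set X) : \bar R :=
  ereal_inf [set delta%:E | delta in [set delta : R | 0 < delta /\
    exists s : seq (X * R),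
      (forall p, p \in s ->
         0 < p.2 /\ (diameter (ball p.1 p.2) < delta%:E)%E) /\
      B `<=` \bigcup_(p in [set` s]) ball p.1 p.2]].

Definition pullback_omega_limit_compact (R : realType) (X : normedModType R)
    (U : R -> R -> X -> set X) : Prop :=
  forall (B : set X) (t : R), nonempty_bounded B ->
    kuratowski (mp_past U t B tau) @[tau --> -oo%R] --> 0%E.

Definition finite_dim_subspace (R : realType) (X : normedModType R)
    (E : set X) : Prop :=
  exists (n : nat) (e : 'I_n -> X),
    E = [set x | exists c : 'I_n -> R, x = \sum_(i < n) c i *: e i].

(* As in the source, P is an arbitrary mapping X -> E: neither linearity nor
   continuity is required. *)
Definition pullback_flattening (R : realType) (X : normedModType R)
    (U : R -> R -> X -> set X) : Prop :=
  forall (B : set X) (t eps : R), nonempty_bounded B -> 0 < eps ->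
  exists (tau : R) (E : set X) (P : X -> X),
    [/\ tau <= t,
        finite_dim_subspace E,
        (forall x, E (P x)),
        nonempty_bounded (P @` mp_past U t B tau) &
        [set x - P x | x in mp_past U t B tau] `<=` ball 0 eps].

(* Main.v *)
Require Import Defs.
From HB Require Import structures.
From mathcomp Require Import all_boot all_order all_algebra.
From mathcomp Require Import all_classical all_reals all_analysis.
From mathcomp Require Import lra finmap.
Import Order.TTheory GRing.Theory Num.Theory.
Import numFieldNormedType.Exports.
Local Open Scope classical_set_scope.
Local Open Scope ring_scope.

(** All four properties say, in different words, that the pasts of the process
    become totally bounded in the limit: for every bounded B, every time t and
    every e > 0, some past of B seen at time t is covered by finitely many
    e-balls ([pasts_have_nets]).  The proof compares each property with this one.

    Asymptotic compactness gives nets, because otherwise one could choose,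
    further and further in the past, points that stay e away from all points
    chosen before, and no subsequence of these would be Cauchy
    ([nets_of_asymptotically_compact]).  Conversely, nets make every ultrafilter
    that contains the pasts a Cauchy filter, since one of finitely many covering
    balls must belong to it; so in a complete space it converges.  Applied to an
    ultrafilter finer than a sequence, this yields convergent subsequences
    ([asymptotically_compact_of_nets]); applied to ultrafilters on the omega-limit
    set, which is closed and within any distance of a past, it yields its
    compactness ([omega_compact]).  Nonemptiness and attraction are the usual
    subsequence arguments ([omega_nonempty], [omega_attracts]); and a compact
    attracting family gives nets, since a finite net of the attractor is also a
    net, of larger radius, of the sets close to it
    ([nets_of_attracting_compact]).

    The measure of noncompactness of the pasts tends to 0 exactly when they have
    nets of all radii, up to constants relating the radius and the diameter of a
    ball ([omega_limit_compactP]).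

    For flattening, nets give the required mapping at once: send every point of a
    past to a center close to it, inside the span of the centers
    ([flattening_of_nets]).  Conversely, a flattened past is uniformly close to
    a bounded part of a finite dimensional subspace, and such parts are totally
    bounded ([finite_dim_bounded_parts]); hence it has a net
    ([nets_of_flattening]). *)

(** * Finite nets in normed spaces *)

Definition has_net {R : realType} {X : normedModType R} (A : set X) (e : R) :=
  exists s : seq X, A `<=` \bigcup_(c in [set` s]) ball c e.

Lemma has_net_subset {R : realType} {X : normedModType R} (A B : set X)
    (e : R) : A `<=` B -> has_net B e -> has_net A e.
Proof. by move=> AB [s Bs]; exists s => x /AB/Bs. Qed.

Lemma has_net_enlarge {R : realType} {X : normedModType R} (A B : set X)
    (e d : R) : (forall x, A x -> exists2 y, B y & `|x - y| < d) ->
  has_net B e -> has_net A (e + d).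
Proof.
move=> AB [s Bs]; exists s => x /AB[y /Bs[c /= cs]].
rewrite -ball_normE /= => cy xy; exists c => //=.
rewrite -(subrKA y) (le_lt_trans (ler_normD _ _))// ltrD// distrC//.
Qed.

Lemma compact_has_net {R : realType} {X : normedModType R} (K : set X)
    (e : R) : compact K -> 0 < e -> has_net K e.
Proof.
rewrite compact_cover => Kc e0.
have [||D DK KD] := Kc X K (fun c => ball c e).
- by move=> c _; exact: ball_open.
- by move=> x Kx; exists x => //; exact: ballxx.
by exists (finmap.enum_fset D).
Qed.

(** An ultrafilter containing a finite union contains one of its members; so it
    contains balls of all radii, and is a Cauchy filter. *)
Lemma ultra_cvg_of_nets {R : realType} {X : completeNormedModType R}
    (F : set_system X) : UltraFilter F ->
  (forall e : R, 0 < e -> exists2 A, F A & has_net A e) ->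
  exists l : X, F --> l.
Proof.
move=> UF Fnet; apply/cvg_ex; apply: cauchy_cvg; apply/cauchyP => e e0.
have [A FA [s As]] := Fnet e e0.
have {As FA} : F (\bigcup_(c in [set` s]) ball c e) by exact: filterS FA.
elim: s => [|c s IHs].
  move=> F0; exfalso; apply: (@filter_not_empty _ F).
  by apply: filterS F0 => x [].
have [Fc _|FNc Fcs] := in_ultra_setVsetC (ball c e) UF; first by exists c.
apply: IHs; apply: filterS (filterI FNc Fcs) => x [/= ncx [y /=]].
by rewrite inE => /predU1P[->|ys xy] //; exists y.
Qed.

Lemma compact_of_nets {R : realType} {X : completeNormedModType R}
    (A : set X) : closed A -> (forall e : R, 0 < e -> has_net A e) ->
  compact A.
Proof.
move=> Acl Anet; rewrite compact_ultra => F UF FA.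
have [|l Fl] := ultra_cvg_of_nets F UF.
  by move=> e /Anet; exists A.
exists l; split=> //; apply: Acl => V /Fl FV.
exact: (@filter_ex _ F _ _ (filterI FA FV)).
Qed.

(** An ultrafilter finer than the sequence has a limit, and this limit is a
    cluster point of the sequence.  To pass from a cluster point l to a
    subsequence, the theorem for real sequences is applied to the distances to
    l, of which 0 is then a cluster point. *)
Lemma subseq_cvg_of_nets {R : realType} {X : completeNormedModType R}
    (u : nat -> X) :
  (forall e : R, 0 < e ->
     exists N, has_net [set u n | n in [set n | (N <= n)%N]] e) ->
  exists (phi : nat -> nat) (l : X),
    {homo phi : m n / (m < n)%N} /\ (u \o phi) @ \oo --> l.
Proof.
move=> unet; have [G [UG uG]] := ultraFilterLemma (F := u @ \oo) _.
have [|l Gl] := ultra_cvg_of_nets G UG.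
  move=> e /unet[N uN]; exists [set u n | n in [set n | (N <= n)%N]] => //.
  by apply: uG; exists N => // n /= Nn; exists n.
have : cluster ((fun n => `|u n - l|) @ \oo) 0.
  apply/cluster_eventuallyP => e n e0.
  have Gn : G [set u p | p in [set p | (n <= p)%N]].
    by apply: uG; exists n => // p /= np; exists p.
  have Gl' : G (ball l e) by apply: Gl; exact: nbhsx_ballx.
  have [x [[p np <-]]] := @filter_ex _ G _ _ (filterI Gn Gl').
  rewrite -ball_normE /= => /ltW lp.
  by exists p => //; rewrite sub0r normrN normr_id distrC.
move=> /cluster_eventually_cvg[phi phi_incr /cvgrPdist_lt phil].
exists phi, l; split.
  move=> m n mn; have := phi_incr n m; rewrite leEnat !ltnNge => ->.
  by rewrite -ltnNge.
apply/cvgrPdist_lt => e /phil; apply: filterS => n /=.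
by rewrite sub0r normrN normr_id distrC.
Qed.

(** * Bounded parts of finite dimensional subspaces *)

Definition bounded_parts_have_nets {R : realType} {X : normedModType R}
    (V : set X) :=
  forall M e : R, 0 < e -> has_net (V `&` [set x | `|x| <= M]) e.

(** Nets of A and of the segment of scalars add up; the radius on the scalars is
    divided by |v| + 1, which is positive also when v = 0. *)
Lemma has_net_add_line {R : realType} {X : normedModType R} (A : set X)
    (v : X) (C e : R) : 0 < e -> has_net A (e / 2) ->
  has_net [set x | exists a c, [/\ A a, `|c| <= C & x = a + c *: v]] e.
Proof.
move=> e0 [s As].
have d0 : 0 < e / 2 / (`|v| + 1) by rewrite !divr_gt0// ltr_wpDl.
have [r Cr] := compact_has_net (X := R) `[- C, C]%classic _
  (@segment_compact R (- C) C) d0.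
exists [seq a + c *: v | a <- s, c <- r] => _ [a [c [Aa cC ->]]].
have [b /= bs] := As a Aa; rewrite -ball_normE /= => ab.
have [|d /= dr] := Cr c; first by rewrite /= in_itv /= -ler_norml.
rewrite -ball_normE /= => cd; exists (b + d *: v) => /=.
  by apply/allpairsP; exists (b, d).
rewrite opprD addrACA -scalerBl.
rewrite (le_lt_trans (ler_normD _ _))// [ltRHS]splitr ltr_leD//.
rewrite normrZ (le_trans (ler_wpM2l _ (_ : `|v| <= `|v| + 1)))//.
  by rewrite lerDl.
by rewrite -ler_pdivlMr ?ltr_wpDl// ltW.
Qed.

(** If v is at distance at least d > 0 from V, then |y + c v| >= |c| d, so a bound
    on y + c v bounds both c and y, and nets of both can be combined.  If v is at
    distance 0 from V, then y + c v is as close as desired to a vector of V, whose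
    norm is bounded too, and a net of a bounded part of V suffices.  This
    alternative avoids any appeal to linear independence, and to the closedness
    of V. *)
Lemma bounded_parts_add_line {R : realType} {X : normedModType R} (V : set X)
    (v : X) :
  (forall x y, V x -> V y -> V (x + y)) ->
  (forall (a : R) x, V x -> V (a *: x)) ->
  bounded_parts_have_nets V ->
  bounded_parts_have_nets [set x | exists y c, V y /\ x = y + c *: v].
Proof.
move=> VD VZ Vnet M e e0.
have e20 : 0 < e / 2 by rewrite divr_gt0.
have [[d d0 dV]|Vv] :=
    pselect (exists2 d, 0 < d & forall y, V y -> d <= `|v - y|).
  have := has_net_add_line _ v (M / d) _ e0 (Vnet (M + M / d * `|v|) _ e20).
  apply: has_net_subset => _ [[y [c [Vy ->]]] /= xM].
  have cM : `|c| <= M / d.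
    have [->|c0] := eqVneq c 0.
      by rewrite normr0 divr_ge0 ?(ltW d0)// (le_trans _ xM).
    rewrite ler_pdivlMr// (le_trans _ xM)//.
    have -> : y + c *: v = c *: (v - (- c^-1) *: y).
      by rewrite scalerBr scalerA mulrN divff// scaleN1r opprK addrC.
    by rewrite normrZ ler_wpM2l// dV//; exact: VZ.
  exists y, c; split => //; split => //=.
  rewrite -(addrK (c *: v) y) (le_trans (ler_normB _ _))// lerD// normrZ.
  by rewrite ler_wpM2r.
(* From here on, v is at distance 0 from V. *)
have near_v d : 0 < d -> exists2 y, V y & `|v - y| < d.
  move=> d0; apply: contrapT => nV; apply: Vv; exists d => // y Vy.
  by rewrite leNgt; apply/negP => vy; apply: nV; exists y.
rewrite [e]splitr; apply: has_net_enlarge (Vnet (M + e / 2) _ e20).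
move=> _ [[y [c [Vy ->]]] /= xM].
have c10 : 0 < `|c| + 1 by rewrite ltr_wpDl.
(* The approximation w of v depends on c, which is not bounded here. *)
have [w Vw vw] := near_v _ (divr_gt0 e20 c10).
have xw : `|(y + c *: v) - (y + c *: w)| < e / 2.
  rewrite opprD addrACA subrr add0r -scalerBr normrZ.
  move: vw; rewrite ltr_pdivlMr// => /le_lt_trans; apply.
  by rewrite mulrC ler_wpM2l// lerDl.
exists (y + c *: w) => //; split; first by apply: VD => //; exact: VZ.
rewrite /= -(subKr (y + c *: v) (y + c *: w)) (le_trans (ler_normB _ _))//.
by rewrite lerD// ltW.
Qed.

Lemma finite_dim_bounded_parts {R : realType} {X : normedModType R}
    (E : set X) : finite_dim_subspace E -> bounded_parts_have_nets E.
Proof.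
move=> [n [e ->]] {E}; elim: n e => [|n IHn] e.
  move=> M d d0; exists [:: 0] => x [[c]] /=; rewrite big_ord0 => -> _.
  by exists 0; [rewrite /= inE|exact: ballxx].
have := bounded_parts_add_line _ (e ord_max) _ _
  (IHn (fun i => e (widen_ord (leqnSn n) i))).
move=> H M d d0; apply: has_net_subset (H _ _ M d d0).
- move=> _ [[c ->] xM]; split => //=; rewrite big_ord_recr /=.
  eexists; exists (c ord_max); split; last by [].
  by exists (fun i => c (widen_ord (leqnSn n) i)).
- move=> _ _ [c ->] [c' ->]; exists (fun i => c i + c' i).
  by rewrite -big_split; apply: eq_bigr => i _; rewrite /= scalerDl.
- move=> a _ [c ->]; exists (fun i => a * c i).
  by rewrite scaler_sumr; apply: eq_bigr => i _; rewrite scalerA.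
Qed.

(** * Finite nets and the measure of noncompactness *)

Lemma cvge0P {R : realType} {T : Type} {F : set_system T} {FF : Filter F}
    (f : T -> \bar R) : (\forall x \near F, (0 <= f x)%E) ->
  f x @[x --> F] --> 0%E <->
  forall e : R, 0 < e -> \forall x \near F, (f x < e%:E)%E.
Proof.
move=> f0; split=> [f_cvg e e0|fe A A0].
  apply: (f_cvg [set y | (y < e%:E)%E]).
  change (nbhs (0 : R) [set r : R | (r%:E < e%:E)%E]).
  near=> r; rewrite /= lte_fin; near: r; exact: lt_nbhsl.
have {A0} : nbhs (0 : R) [set r : R | A r%:E] by exact: A0.
move=> /nbhs_ballP[e /= e0 eA].
apply: filterS2 f0 (fe e e0) => x; rewrite /preimage /=.
case: (f x) => [r| |] //; rewrite lee_fin lte_fin => r0 re; apply: eA.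
by rewrite -ball_normE /= sub0r normrN ger0_norm.
Unshelve. all: by end_near. Qed.

(** A ball of radius e has diameter at most 2e, and the covers that define the
    measure have diameter strictly below delta; hence the factor 3. *)
Lemma has_net_kuratowski {R : realType} {X : normedModType R} (A : set X)
    (e : R) : 0 < e -> has_net A e -> (kuratowski A <= (3 * e)%:E)%E.
Proof.
move=> e0 [s As]; apply: ereal_inf_lbound; exists (3 * e) => //.
split; first by rewrite mulr_gt0.
exists [seq (c, e) | c <- s]; split.
  move=> _ /mapP[c cs ->]; split=> //=.
  apply: (@le_lt_trans _ _ (2 * e)%:E); last by rewrite lte_fin ltr_pM2r// ltr_nat.
  apply/ereal_supP => _ [[x y] /= [cx cy] <-]; rewrite lee_fin.
  move: cx cy; rewrite -ball_normE /= => cx cy.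
  rewrite -(subrKA c) (le_trans (ler_normD _ _))// mulrC mulr_natr mulr2n.
  by rewrite lerD// ltW// distrC.
by move=> x /As[c /= cs cx]; exists (c, e) => //=; apply: map_f.
Qed.

Lemma kuratowski_ge0 {R : realType} {X : normedModType R} (A : set X) :
  (0 <= kuratowski A)%E.
Proof. by apply: le_ereal_inf_tmp => _ [d [d0 _] <-]; rewrite lee_fin ltW. Qed.

(** The center of a ball is at most the diameter away from its points, so only the
    diameters of the covering balls matter here, not their radii, which may be
    larger when the space is trivial. *)
Lemma kuratowski_lt_has_net {R : realType} {X : normedModType R} (A : set X)
    (e : R) : (kuratowski A < e%:E)%E -> has_net A e.
Proof.
move=> /ereal_inf_lt[_ [d [d0 [s [sd As]]] <-]]; rewrite lte_fin => de.
exists [seq p.1 | p <- s] => x /As[p /= ps px].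
have [p0 pd] := sd p ps; exists p.1; first by rewrite /=; apply: map_f.
rewrite -ball_normE /= -lte_fin; apply: (le_lt_trans _ (lt_trans pd _)).
  apply: ereal_sup_ubound; exists (p.1, x) => //; split=> //=.
  exact: ballxx.
by rewrite lte_fin.
Qed.

(** * Pasts of an m-process *)

Lemma mp_past_mono {R : realType} {X : normedModType R}
    (U : R -> R -> X -> set X) (t : R) (B : set X) (a b : R) :
  a <= b -> mp_past U t B a `<=` mp_past U t B b.
Proof. by move=> ab x [s /= sa Usx]; exists s => //=; exact: le_trans ab. Qed.

Lemma mp_image_past {R : realType} {X : normedModType R}
    (U : R -> R -> X -> set X) (t s a : R) (B : set X) :
  s <= a -> mp_image U t s B `<=` mp_past U t B a.
Proof. by move=> sa x Usx; exists s. Qed.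

Lemma mp_image_nonempty {R : realType} {X : normedModType R}
    {U : R -> R -> X -> set X} {t s : R} {B : set X} :
  m_process U -> B !=set0 -> s <= t -> mp_image U t s B !=set0.
Proof.
by move=> UP [b Bb] st; have [x Ux] := mp_nonempty UP b st; exists x, b.
Qed.

Lemma near_ninfty_le {R : realType} (P : set R) (t : R) :
  (\forall s \near -oo, P s) -> exists2 a, a <= t & forall s, s <= a -> P s.
Proof.
move=> [M [_ MP]]; exists (Num.min t (M - 1)); first by rewrite ge_min lexx.
by move=> s; rewrite le_min => /andP[_ sM]; apply: MP; lra.
Qed.

Lemma cvg_ninfty_le_natr {R : realType} (t : R) (tau : nat -> R) :
  (forall n, tau n <= t - n%:R) -> tau @ \oo --> -oo%R.
Proof.
move=> taun; apply/cvgrNyPle => A; near=> n.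
rewrite (le_trans (taun n))// lerBlDr -lerBlDl.
near: n; exact: nbhs_infty_ger.
Unshelve. all: by end_near. Qed.

(** Total boundedness of the pasts in the limit, the property through which all
    equivalences are proved. *)
Definition pasts_have_nets {R : realType} {X : normedModType R}
    (U : R -> R -> X -> set X) :=
  forall (B : set X) (t e : R), nonempty_bounded B -> 0 < e ->
  exists2 tau, tau <= t & has_net (mp_past U t B tau) e.

Lemma asymptotically_compact_of_nets {R : realType}
    {X : completeNormedModType R} (U : R -> R -> X -> set X) :
  pasts_have_nets U -> asymptotically_compact U.
Proof.
move=> Unet B t bB tau xi taut tauNy xiU; apply: subseq_cvg_of_nets => e e0.
have [a at_ anet] := Unet B t e bB e0.
have [N _ Na] := (cvgrNyPle tau).1 tauNy a.
exists N; apply: has_net_subset anet => _ [n /= Nn <-].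
by apply: mp_image_past (xiU n); exact: Na.
Qed.

(** Without a net of radius e, a point at distance at least e from any finitely
    many given ones exists arbitrarily far in the past; iterating this produces
    a sequence without Cauchy subsequences. *)
Lemma nets_of_asymptotically_compact {R : realType} {X : normedModType R}
    (U : R -> R -> X -> set X) :
  asymptotically_compact U -> pasts_have_nets U.
Proof.
move=> Uac B t e bB e0; apply: contrapT => nonet.
have /choice[g gP] : forall s : seq X, exists p : R * X,
    [/\ p.1 <= t - (size s)%:R, mp_image U t p.1 B p.2 &
        forall c, c \in s -> e <= `|c - p.2|].
  move=> s; apply: contrapT => noP; apply: nonet.
  have tn : t - (size s)%:R <= t by rewrite gerBl.
  exists (t - (size s)%:R) => //; exists s => x [a /= an Ux].
  apply: contrapT => xs; apply: noP; exists (a, x); split => //= c cs.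
  rewrite leNgt; apply/negP => cx; apply: xs; exists c => //.
  by rewrite -ball_normE.
(* The states of the iteration are the lists of the points chosen so far, most
   recent first; their length also tells how far in the past to look next. *)
pose s n := iter n (fun s => (g s).2 :: s) [::].
have szs n : size (s n) = n by elim: n => //= n ->.
have sP m n : (m < n)%N -> (g (s m)).2 \in s n.
  elim: n => // n IHn; rewrite ltnS leq_eqVlt => /predU1P[->|/IHn] /=.
    by rewrite inE eqxx.
  by rewrite inE => ->; rewrite orbT.
have taun n : (g (s n)).1 <= t - n%:R by have [] := gP (s n); rewrite szs.
have [n||n|phi [l [phi_incr phil]]] :=
    Uac B t bB (fun n => (g (s n)).1) (fun n => (g (s n)).2).
- by rewrite (le_trans (taun n))// gerBl.
- exact: cvg_ninfty_le_natr taun.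
- by have [] := gP (s n).
have e20 : 0 < e / 2 by rewrite divr_gt0.
have [N _ Nl] := (cvgrPdist_lt _ _).1 phil _ e20.
have [_ _ /(_ (g (s (phi N))).2)] := gP (s (phi N.+1)).
move=> /(_ (sP _ _ (phi_incr _ _ (ltnSn N)))); rewrite leNgt => /negP; apply.
rewrite -(subrKA l) (le_lt_trans (ler_normD _ _))// [ltRHS]splitr ltrD//.
  by rewrite distrC; exact: (Nl N (leqnn N)).
exact: (Nl N.+1 (leqnSn N)).
Qed.

(** What makes a subsequential limit given by asymptotic compactness a point of
    the omega-limit set: the sequence eventually enters every past. *)
Lemma subseq_cvg_omega {R : realType} {X : normedModType R}
    (U : R -> R -> X -> set X) (B : set X) (t : R) (tau : nat -> R)
    (xi : nat -> X) (phi : nat -> nat) (l : X) :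
  tau @ \oo --> -oo%R -> (forall n, mp_image U t (tau n) B (xi n)) ->
  {homo phi : m n / (m < n)%N} -> (xi \o phi) @ \oo --> l -> omega U t B l.
Proof.
move=> tauNy xiU phi_incr phil s _ V /phil[N1 _ N1V].
have [N2 _ N2s] := (cvgrNyPle tau).1 tauNy s.
have phi_ge n : (n <= phi n)%N.
  by elim: n => // n IHn; apply: leq_ltn_trans IHn (phi_incr _ _ (ltnSn n)).
pose n := maxn N1 N2; exists (xi (phi n)); split.
  apply: mp_image_past (xiU _); apply: N2s => /=.
  by rewrite (leq_trans _ (phi_ge n))// leq_maxr.
by apply: N1V; rewrite /= leq_maxl.
Qed.

(** The omega-limit set lies in the closure of every past, so a net of a past is
    a net of it, of slightly larger radius. *)
Lemma omega_compact {R : realType} {X : completeNormedModType R}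
    (U : R -> R -> X -> set X) (B : set X) (t : R) :
  pasts_have_nets U -> nonempty_bounded B -> compact (omega U t B).
Proof.
move=> Unet bB; apply: compact_of_nets.
  by apply: closed_bigI => s _; exact: closed_closure.
move=> e e0; have e20 : 0 < e / 2 by rewrite divr_gt0.
have [s st snet] := Unet B t _ bB e20.
rewrite [e]splitr; apply: has_net_enlarge snet => x /(_ s st).
move=> /(_ _ (nbhsx_ballx x _ e20))[y [sy]]; rewrite -ball_normE /= => xy.
by exists y.
Qed.

Lemma omega_nonempty {R : realType} {X : normedModType R}
    {U : R -> R -> X -> set X} (B : set X) (t : R) : m_process U ->
  asymptotically_compact U -> nonempty_bounded B -> omega U t B !=set0.
Proof.
move=> UP Uac bB; have tn n : t - n%:R <= t :> R by rewrite gerBl.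
have /choice[xi xiU] n := mp_image_nonempty UP bB.1 (tn n).
have tauNy := cvg_ninfty_le_natr t (fun n => t - n%:R) (fun n => lexx _).
have [phi [l [phi_incr phil]]] := Uac B t bB _ xi tn tauNy xiU.
by exists l; exact: subseq_cvg_omega tauNy xiU phi_incr phil.
Qed.

Lemma dist_point_lt {R : realType} {X : normedModType R} (y : X) (A : set X)
    (e : R) : (dist_point y A < e%:E)%E <-> exists2 x, A x & `|y - x| < e.
Proof.
split=> [/ereal_inf_lt[_ [x Ax <-]]|[x Ax yx]].
  by rewrite lte_fin distrC; exists x.
by apply/ereal_inf_ltP; exists (`|x - y|)%:E; [exists x|rewrite lte_fin distrC].
Qed.

Lemma dist_set_ge0 {R : realType} {X : normedModType R} (A B : set X) :
  A !=set0 -> (0 <= dist_set A B)%E.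
Proof.
move=> [y Ay]; apply: (@le_trans _ _ (dist_point y B)).
  by apply: le_ereal_inf_tmp => _ [x _ <-]; rewrite lee_fin.
by apply: ereal_sup_ubound; exists y.
Qed.

(** Points of the past staying e away from the omega-limit set would have a
    subsequence converging to one of its points. *)
Lemma omega_attracts {R : realType} {X : normedModType R}
    {U : R -> R -> X -> set X} (B : set X) : m_process U ->
  asymptotically_compact U -> nonempty_bounded B ->
  pullback_attracts U (fun t => omega U t B) B.
Proof.
move=> UP Uac bB t; apply/cvge0P.
  near=> s; apply/dist_set_ge0/(mp_image_nonempty UP bB.1).
  near: s; exact: nbhs_ninfty_le (num_real t).
move=> e e0; have e20 : 0 < e / 2 by rewrite divr_gt0.
suff [a aP] : exists a, forall s x, s <= a -> mp_image U t s B x ->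
    exists2 y, omega U t B y & `|x - y| < e / 2.
  near=> s; have sa : s <= a by near: s; exact: nbhs_ninfty_le (num_real a).
  apply: (@le_lt_trans _ _ (e / 2)%:E).
    by apply/ereal_supP => _ [x Ux <-]; apply/ltW/dist_point_lt; exact: aP sa Ux.
  by rewrite lte_fin ltr_pdivrMr// ltr_pMr// ltr1n.
apply: contrapT => noa.
have /choice[p pP] : forall n : nat, exists p : R * X,
    [/\ p.1 <= t - n%:R, mp_image U t p.1 B p.2 &
        ~ exists2 y, omega U t B y & `|p.2 - y| < e / 2].
  move=> n; apply: contrapT => nop; apply: noa; exists (t - n%:R) => s x sn Ux.
  by apply: contrapT => xy; apply: nop; exists (s, x).
have pn n : (p n).1 <= t - n%:R by have [] := pP n.
have pt n : (p n).1 <= t by rewrite (le_trans (pn n))// gerBl.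
have pU n : mp_image U t (p n).1 B (p n).2 by have [] := pP n.
have pNy := cvg_ninfty_le_natr _ _ pn.
have [phi [l [phi_incr phil]]] := Uac B t bB _ _ pt pNy pU.
have [N _ /(_ N (leqnn N)) /= Nl] := (cvgrPdist_lt _ _).1 phil _ e20.
have [_ _] := pP (phi N); apply; exists l; last by rewrite distrC.
exact: subseq_cvg_omega pNy pU phi_incr phil.
Unshelve. all: by end_near. Qed.

(** For early enough s the sets U(t, s; B) all lie close to the same compact set,
    so that the finite net of the latter serves for their union. *)
Lemma nets_of_attracting_compact {R : realType} {X : normedModType R}
    (U : R -> R -> X -> set X) :
  m_process U -> (forall B, nonempty_bounded B -> exists2 K, compact_family K &
     pullback_attracts U K B) ->
  pasts_have_nets U.
Proof.
move=> UP UK B t e bB e0; have e20 : 0 < e / 2 by rewrite divr_gt0.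
have [K Kc KB] := UK B bB.
have d0 : \forall s \near -oo, (0 <= dist_set (mp_image U t s B) (K t))%E.
  near=> s; apply/dist_set_ge0/(mp_image_nonempty UP bB.1).
  near: s; exact: nbhs_ninfty_le (num_real t).
have [a at_ aK] := near_ninfty_le _ t ((cvge0P _ d0).1 (KB t) _ e20).
exists a => //; rewrite [e]splitr.
apply: has_net_enlarge (compact_has_net _ _ (Kc t) e20) => x [s /= sa Ux].
apply/dist_point_lt; apply: le_lt_trans (aK s sa).
by apply: ereal_sup_ubound; exists x.
Unshelve. all: by end_near. Qed.

Lemma omega_limit_compactP {R : realType} {X : normedModType R}
    (U : R -> R -> X -> set X) :
  pullback_omega_limit_compact U <-> pasts_have_nets U.
Proof.
have k0 t B : \forall s \near -oo, (0 <= kuratowski (mp_past U t B s))%E.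
  by near=> s; exact: kuratowski_ge0.
split=> [Uk B t e bB e0|Unet B t bB].
  have [a at_ ak] := near_ninfty_le _ t ((cvge0P _ (k0 t B)).1 (Uk B t bB) e e0).
  by exists a => //; apply: kuratowski_lt_has_net; exact: ak.
apply/(cvge0P _ (k0 t B)) => e e0; have e40 : 0 < e / 4 by rewrite divr_gt0.
have [a _ anet] := Unet B t _ bB e40; near=> s.
apply: (@le_lt_trans _ _ (3 * (e / 4))%:E); last by rewrite lte_fin; lra.
apply: has_net_kuratowski => //; apply: has_net_subset anet.
by apply: mp_past_mono; near: s; exact: nbhs_ninfty_le (num_real a).
Unshelve. all: by end_near. Qed.

(** No regularity is asked of the mapping, so it may choose, for each point of the
    past, a center close to it; its finite range is bounded and spans a finite
    dimensional subspace.  The point 0 is added to the centers as the value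
    outside the past. *)
Lemma flattening_of_nets {R : realType} {X : normedModType R}
    (U : R -> R -> X -> set X) :
  m_process U -> pasts_have_nets U -> pullback_flattening U.
Proof.
move=> UP Unet B t e bB e0; have [a at_ [s As]] := Unet B t e bB e0.
pose s0 : seq X := 0 :: s.
have /choice[P Ps] : forall x : X, exists y : X,
    y \in s0 /\ (mp_past U t B a x -> ball y e x).
  move=> x; have [Ax|nAx] := pselect (mp_past U t B a x).
    by have [c /= cs cx] := As x Ax; exists c; rewrite inE cs orbT.
  by exists 0; rewrite inE eqxx.
exists a, [set x | exists c : 'I_(size s0) -> R,
    x = \sum_(i < size s0) c i *: s0`_i], P; split => //.
- by exists (size s0), (fun i => s0`_i).
- move=> x; have [Px _] := Ps x.
  have Pi : (index (P x) s0 < size s0)%N by rewrite index_mem.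
  (* P x is the combination with coefficient 1 at its own position. *)
  exists (fun i => (i == Ordinal Pi)%:R); rewrite (bigD1 (Ordinal Pi))//=.
  rewrite big1 => [|i /negbTE ->]; last by rewrite scale0r.
  by rewrite eqxx scale1r addr0 [RHS](nth_index 0 Px).
- split.
    have [x Ux] := mp_image_nonempty UP bB.1 at_.
    by exists (P x), x => //; exists a => /=.
  exists (\sum_(c <- s0) `|c|); split; first exact: num_real.
  move=> M /ltW sM _ [x _ <-] /=; apply: le_trans sM.
  by have [Px _] := Ps x; rewrite (big_rem _ Px)/= lerDl sumr_ge0.
move=> _ [x Ax <-]; have [_ /(_ Ax)] := Ps x.
by rewrite -!ball_normE /= sub0r normrN distrC.
Qed.

Lemma nets_of_flattening {R : realType} {X : normedModType R}
    (U : R -> R -> X -> set X) : pullback_flattening U -> pasts_have_nets U.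
Proof.
move=> Uf B t e bB e0; have e20 : 0 < e / 2 by rewrite divr_gt0.
have [a [E [P [at_ Ef EP [_ bP] IP]]]] := Uf B t _ bB e20.
have [M [_ /(_ (M + 1))]] := bP; rewrite ltrDl ltr01 => /(_ isT) PM.
exists a => //; rewrite [e]splitr.
apply: has_net_enlarge (finite_dim_bounded_parts E Ef (M + 1) _ e20).
move=> x Ax; exists (P x).
  by split=> //; apply: PM; exists x.
have : ball 0 (e / 2) (x - P x) by apply: IP; exists x.
by rewrite -ball_normE /= sub0r normrN.
Qed.

(** * The equivalence *)

Theorem theorem2p13 (R : realType) (X : completeNormedModType R)
    (U : R -> R -> X -> set X)
    (hX : uniformly_convex X) (hU : m_process U) :
  [<-> asymptotically_compact U ;
       forall B : set X, nonempty_bounded B ->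
         [/\ forall t : R, omega U t B !=set0,
             compact_family (fun t : R => omega U t B) &
             pullback_attracts U (fun t : R => omega U t B) B] ;
       pullback_omega_limit_compact U ;
       pullback_flattening U].
Proof.
tfae.
- move=> Uac B bB; have Unet := nets_of_asymptotically_compact U Uac.
  split; first by move=> t; exact: omega_nonempty.
    by move=> t; exact: omega_compact.
  exact: omega_attracts.
- move=> UO; apply/omega_limit_compactP; apply: nets_of_attracting_compact => //.
  by move=> B /UO[_ Oc OB]; exists (fun t => omega U t B).
- by move=> /omega_limit_compactP; exact: flattening_of_nets.
- by move=> Uf; apply: asymptotically_compact_of_nets; exact: nets_of_flattening.
Qed.
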